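(* Let $S$ be a $\Gamma$-semiring which has a left unity and a right unity, and let $L$ be its left operator semiring. For a fuzzy subset $\sigma$ of $S$ let $\sigma^{+'}$ be the fuzzy subset of $L$ given by $\sigma^{+'}(\sum_i[x_i,\alpha_i])=\inf_{a\in S}\sigma(\sum_i x_i\alpha_i a)$, and for a fuzzy subset $\mu$ of $L$ let $\mu^{+}$ be the fuzzy subset of $S$ given by $\mu^{+}(a)=\inf_{\alpha\in\Gamma}\mu([a,\alpha])$. Then: (1) if $\sigma$ is a fuzzy $h$-ideal of $S$, then $\sigma^{+'}$ is a fuzzy $h$-ideal of $L$; (2) if $\mu$ is a fuzzy $h$-ideal of $L$, then $\mu^{+}$ is a fuzzy $h$-ideal of $S$.
   Context: $\Gamma$-semiring: $S$ and $\Gamma$ are (nonempty) additive commutative semigroups with a map $S\times\Gamma\times S\to S$, $(a,\alpha,b)\mapsto a\alpha b$, such that $a\alpha(b+c)=a\alpha b+a\alpha c$, $(a+b)\alpha c=a\alpha c+b\alpha c$, $a(\alpha+\beta)c=a\alpha c+a\beta c$, $a\alpha(b\beta c)=(a\alpha b)\beta c$ for all $a,b,c\in S$, $\alpha,\beta\in\Gamma$. No zero elements are assumed. Left operator semiring $L$: let $F$ be the free additive commutative semigroup generated by $S\times\Gamma$ (finite nonempty formal sums). The relation $\sum_i(x_i,\alpha_i)\,\rho\,\sum_j(y_j,\beta_j)$ iff $\sum_i x_i\alpha_i a=\sum_j y_j\beta_j a$ for all $a\in S$ is a congruence on $F$. The class of $\sum_i(x_i,\alpha_i)$ is written $\sum_i[x_i,\alpha_i]$.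 $L=F/\rho$ with the induced addition and the multiplication $(\sum_i[x_i,\alpha_i])(\sum_j[y_j,\beta_j])=\sum_{i,j}[x_i\alpha_i y_j,\beta_j]$ is a semiring. Unities: a left unity of $S$ is a finite sum $\sum_i[e_i,\delta_i]\in L$ with $\sum_i e_i\delta_i a=a$ for all $a\in S$. A right unity of $S$ is given by finitely many $\gamma_j\in\Gamma$, $f_j\in S$ with $\sum_j a\gamma_j f_j=a$ for all $a\in S$. A fuzzy subset of a set $X$ is a function $X\to[0,1]$. A fuzzy subset $\mu$ of $S$ is a fuzzy ideal of $S$ if $\mu(a+b)\ge\min(\mu(a),\mu(b))$, $\mu(a\alpha b)\ge\mu(a)$ and $\mu(a\alpha b)\ge\mu(b)$ for all $a,b\in S$, $\alpha\in\Gamma$. A fuzzy subset $\mu$ of $L$ is a fuzzy ideal of $L$ if $\mu(p+q)\ge\min(\mu(p),\mu(q))$, $\mu(pq)\ge\mu(p)$ and $\mu(pq)\ge\mu(q)$ for all $p,q\in L$. A fuzzy ideal $\mu$ (of $S$ or of $L$) is a fuzzy $h$-ideal if for all $x,z,y_1,y_2$ (in $S$, respectively in $L$), $x+y_1+z=y_2+z$ implies $\mu(x)\ge\min(\mu(y_1),\mu(y_2))$. *)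

(* Defs.v *)
From HB Require Import structures.
From mathcomp Require Import all_boot all_order all_algebra.
From mathcomp Require Import finmap multiset generic_quotient.
From mathcomp Require Import boolp classical_sets reals.

Set Implicit Arguments.
Unset Strict Implicit.
Unset Printing Implicit Defensive.

Import Order.TTheory GRing.Theory Num.Theory.
Local Open Scope classical_set_scope.
Local Open Scope quotient_scope.
Local Open Scope mset_scope.
Local Open Scope ring_scope.

(* The free additive commutative semigroup on T, as the nonempty finite
   multisets. *)

Record fsum (T : choiceType) := FSum {
  fsum_mset :> {mset T};
  fsum_neq0 : fsum_mset != mset0 }.

HB.instance Definition _ (T : choiceType) := [isSub for @fsum_mset T].
HB.instance Definition _ (T : choiceType) := [Choice of fsum T by <:].

Section FreeSemigroup.
Variable T : choiceType.
Implicit Types (f g : fsum T) (x : T).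

Lemma fsum_has f : exists x, x \in (f : {mset T}).
Proof.
apply: contrapT => h; case/eqP: (fsum_neq0 f); apply/msetP => x.
rewrite mset0E; apply/eqP; rewrite mset_eq0; apply/negP => xf.
by apply: h; exists x.
Qed.

Lemma fsum1_subproof x : [mset x] != mset0.
Proof.
apply/eqP => /msetP /(_ x).
by rewrite msetnxx mset0E.
Qed.

Definition fsum1 x : fsum T := FSum (fsum1_subproof x).

Lemma fsum_add_subproof f g :
  (f : {mset T}) `+` (g : {mset T}) != mset0.
Proof.
have [x xf] := fsum_has f.
apply/eqP => /msetP /(_ x); rewrite msetE2 mset0E => /eqP.
by rewrite addn_eq0 mset_eq0 xf.
Qed.

Definition fsum_add f g : fsum T := FSum (fsum_add_subproof f g).

Lemma fsum_addC : commutative fsum_add.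
Proof. by move=> f g; apply/val_inj; rewrite /= msetDC. Qed.

Lemma fsum_addA : associative fsum_add.
Proof. by move=> f g h; apply/val_inj; rewrite /= msetDA. Qed.

HB.instance Definition _ :=
  GRing.isAddSemigroup.Build (fsum T) fsum_addC fsum_addA.

Lemma fsum_ind (P : fsum T -> Prop) :
  (forall x, P (fsum1 x)) -> (forall f g, P f -> P g -> P (f + g)) ->
  forall f, P f.
Proof.
move=> P1 PD f.
suff H (s : seq T) : forall h : fsum T, (h : {mset T}) = seq_mset s -> P h.
  by apply: (H (f : {mset T})); rewrite seq_mset_id.
elim: s => [|x s IH] h hs.
  case/eqP: (fsum_neq0 h); rewrite hs.
  by apply/msetP => y; rewrite mset_seqE mset0E.
have [sE|s0] := eqVneq s [::].
  suff -> : h = fsum1 x by [].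
  apply/val_inj; rewrite /= hs sE; apply/msetP => y.
  by rewrite mset_seqE msetnE /= addn0 eq_sym; case: eqP.
have t0 : seq_mset s != mset0.
  case: s s0 {IH hs} => // y s _; apply/eqP => /msetP /(_ y).
  by rewrite mset_seqE mset0E /= eqxx.
suff -> : h = fsum1 x + FSum t0 by apply: PD => //; apply: IH.
apply/val_inj; rewrite /= hs; apply/msetP => y.
by rewrite msetE2 !mset_seqE msetnE /= eq_sym; case: eqP.
Qed.

Variable V : addSemigroupType.
Implicit Type h : T -> V.

(* The value of the formal sum f under h, i.e. the sum of the h x for x in f.
   As V has no zero, the sum is computed in option V with None adjoined as
   neutral element; it is never None, and the default is never used, because f
   is nonempty. *)
Definition fsum_eval h f : V :=
  odflt (h (xchoose (fsum_has f)))
    (\big[oAC (@Algebra.addrA V) (@Algebra.addrC V)/None]_(x <- (f : {mset T}))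
        Some (h x)).

Lemma fsum_evalE h f :
  \big[oAC (@Algebra.addrA V) (@Algebra.addrC V)/None]_(x <- (f : {mset T}))
    Some (h x) =
  Some (fsum_eval h f).
Proof.
rewrite /fsum_eval; move: (h (xchoose _)) => d.
have [x] := fsum_has f; change (x \in (f : {mset T})) with (x \in enum_mset f).
case: (enum_mset f) => // y s _.
by rewrite big_cons; case: (\big[_/_]_(_ <- _) _).
Qed.

Lemma fsum_eval1 h x : fsum_eval h (fsum1 x) = h x.
Proof. by apply: Some_inj; rewrite -fsum_evalE /= enum_msetn big_seq1. Qed.

Lemma fsum_evalD h f g :
  fsum_eval h (f + g) = fsum_eval h f + fsum_eval h g.
Proof.
apply: Some_inj; rewrite -fsum_evalE.
rewrite -(oACE (@Algebra.addrA V) (@Algebra.addrC V)) -!fsum_evalE -big_cat /=.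
apply: perm_big; apply/allP => x _ /=.
by rewrite count_cat !count_mem_mset msetE2.
Qed.

End FreeSemigroup.

Lemma eq_fsum_eval (T : choiceType) (V : addSemigroupType) (h k : T -> V) :
  h =1 k -> fsum_eval h =1 fsum_eval k.
Proof.
by move=> hk; elim/fsum_ind => [x|f g]; rewrite ?fsum_eval1 ?fsum_evalD // => -> ->.
Qed.

Lemma fsum_eval_morph (T : choiceType) (V W : addSemigroupType)
    (u : V -> W) (h : T -> V) :
  {morph u : x y / x + y} ->
  forall f, u (fsum_eval h f) = fsum_eval (u \o h) f.
Proof.
move=> uD; elim/fsum_ind => [x|f g]; first by rewrite !fsum_eval1.
by rewrite !fsum_evalD uD => -> ->.
Qed.

Lemma fsum_eval_add (T : choiceType) (V : addSemigroupType) (h k : T -> V) f :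
  fsum_eval (fun x => h x + k x) f = fsum_eval h f + fsum_eval k f.
Proof.
elim/fsum_ind: f => [x|f g]; first by rewrite !fsum_eval1.
by rewrite !fsum_evalD => -> ->; rewrite Algebra.addrACA.
Qed.

Record gamma_semiring (S G : addSemigroupType) := GammaSemiring {
  gact :> S -> G -> S -> S;
  gS_inhabited : inhabited S;
  gG_inhabited : inhabited G;
  gactDr : forall a al b c, gact a al (b + c) = gact a al b + gact a al c;
  gactDl : forall a b al c, gact (a + b) al c = gact a al c + gact b al c;
  gactDm : forall a al be c, gact a (al + be) c = gact a al c + gact a be c;
  gactA : forall a al b be c,
    gact a al (gact b be c) = gact (gact a al b) be c }.

Section LeftOperatorSemiring.
Variables (S G : addSemigroupType) (M : gamma_semiring S G).
Implicit Types (f g : fsum (S * G)%type) (a : S).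

Definition fact f a : S := fsum_eval (fun p => M p.1 p.2 a) f.

Definition rho f g : bool := `[< forall a, fact f a = fact g a >].

Lemma rhoP f g : reflect (forall a, fact f a = fact g a) (rho f g).
Proof. exact: asboolP. Qed.

Lemma rho_refl : reflexive rho.
Proof. by move=> f; apply/rhoP. Qed.

Lemma rho_sym : symmetric rho.
Proof. by move=> f g; apply/rhoP/rhoP => h a; rewrite h. Qed.

Lemma rho_trans : transitive rho.
Proof. by move=> g f h /rhoP fg /rhoP gh; apply/rhoP => a; rewrite fg. Qed.

Canonical rho_equiv := EquivRel rho rho_refl rho_sym rho_trans.

Definition left_op := {eq_quot rho}.

HB.instance Definition _ := Choice.on left_op.
HB.instance Definition _ := EqQuotient.on left_op.

Lemma factD f g a : fact (f + g) a = fact f a + fact g a.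
Proof. exact: fsum_evalD. Qed.

Lemma fact_add f : {morph fact f : a b / a + b}.
Proof.
move=> a b; rewrite /fact -fsum_eval_add.
by apply: eq_fsum_eval => p; rewrite gactDr.
Qed.

Lemma pi_left_op f g :
  (forall a, fact f a = fact g a) <-> \pi_left_op f = \pi_left_op g.
Proof. by split => [h|/eqmodP /rhoP //]; apply/eqmodP/rhoP. Qed.

(* sum_i [x_i, al_i] acting on a, i.e. sum_i x_i al_i a *)
Definition lact (p : left_op) a : S := fact (repr p) a.

Lemma lact_pi f a : lact (\pi_left_op f) a = fact f a.
Proof.
rewrite /lact; have /pi_left_op -> // :
  \pi_left_op (repr (\pi_left_op f)) = \pi_left_op f.
by rewrite reprK.
Qed.

Lemma lact_inj (p q : left_op) : (forall a, lact p a = lact q a) -> p = q.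
Proof.
by move=> h; rewrite -[p]reprK -[q]reprK; apply/pi_left_op.
Qed.

Lemma lact_addr (p : left_op) : {morph lact p : a b / a + b}.
Proof. exact: fact_add. Qed.

Definition ladd (p q : left_op) : left_op := \pi_left_op (repr p + repr q).

Lemma lact_ladd p q a : lact (ladd p q) a = lact p a + lact q a.
Proof. by rewrite lact_pi factD. Qed.

Lemma laddC : commutative ladd.
Proof.
by move=> p q; apply: lact_inj => a; rewrite !lact_ladd Algebra.addrC.
Qed.

Lemma laddA : associative ladd.
Proof.
by move=> p q r; apply: lact_inj => a; rewrite !lact_ladd Algebra.addrA.
Qed.

HB.instance Definition _ := GRing.isAddSemigroup.Build left_op laddC laddA.

Lemma lactD (p q : left_op) a : lact (p + q) a = lact p a + lact q a.
Proof. exact: lact_ladd. Qed.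

Lemma pi_ladd f g : \pi_left_op (f + g) = \pi_left_op f + \pi_left_op g.
Proof. by apply: lact_inj => a; rewrite lactD !lact_pi factD. Qed.

(* The formal sum of the (x_i al_i y_j, be_j) over all i and j. *)
Definition fmul f g : fsum (S * G)%type :=
  fsum_eval (fun p => fsum_eval (fun q => fsum1 (M p.1 p.2 q.1, q.2)) g) f.

Lemma fact_fmul f g a : fact (fmul f g) a = fact f (fact g a).
Proof.
rewrite [in RHS]/fact /fmul (@fsum_eval_morph _ _ _ (fun k => fact k a)); last first.
  by move=> ? ?; rewrite factD.
apply: eq_fsum_eval => p /=.
rewrite (@fsum_eval_morph _ _ _ (fun k => fact k a)); last first.
  by move=> ? ?; rewrite factD.
rewrite (@fsum_eval_morph _ _ _ (M p.1 p.2)); last exact: gactDr.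
by apply: eq_fsum_eval => q /=; rewrite /fact fsum_eval1 gactA.
Qed.

Definition lmul (p q : left_op) : left_op :=
  \pi_left_op (fmul (repr p) (repr q)).

Lemma lactM p q a : lact (lmul p q) a = lact p (lact q a).
Proof. by rewrite lact_pi fact_fmul. Qed.

Lemma pi_lmul f g :
  \pi_left_op (fmul f g) = lmul (\pi_left_op f) (\pi_left_op g).
Proof. by apply: lact_inj => a; rewrite lactM !lact_pi fact_fmul. Qed.

Lemma lmulA : associative lmul.
Proof. by move=> p q r; apply: lact_inj => a; rewrite !lactM. Qed.

Lemma lmulDl : left_distributive lmul +%R.
Proof. by move=> p q r; apply: lact_inj => a; rewrite !(lactM, lactD). Qed.

Lemma lmulDr : right_distributive lmul +%R.
Proof.
by move=> p q r; apply: lact_inj => a; rewrite !(lactM, lactD, lact_addr).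
Qed.

(* The class [x, al] *)
Definition lgen (x : S) (al : G) : left_op := \pi_left_op (fsum1 (x, al)).

Lemma lact_lgen x al a : lact (lgen x al) a = M x al a.
Proof. by rewrite lact_pi /fact fsum_eval1. Qed.

Definition has_left_unity : Prop :=
  exists e : left_op, forall a, lact e a = a.

Definition has_right_unity : Prop :=
  exists e : fsum (G * S)%type,
    forall a, fsum_eval (fun p => M a p.1 p.2) e = a.

End LeftOperatorSemiring.

Record fuzzy_subset (R : realType) (X : Type) := FuzzySubset {
  fuzzy_val :> X -> R;
  fuzzy_val01 : forall x, 0 <= fuzzy_val x <= 1 }.

Section FuzzyIdeals.
Variables (R : realType) (S G : addSemigroupType) (M : gamma_semiring S G).

Definition fuzzy_ideal (mu : fuzzy_subset R S) : Prop :=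
  (forall a b, Num.min (mu a) (mu b) <= mu (a + b)) /\
  (forall a al b, mu a <= mu (M a al b) /\ mu b <= mu (M a al b)).

Definition fuzzy_left_op_ideal (mu : fuzzy_subset R (left_op M)) : Prop :=
  (forall p q, Num.min (mu p) (mu q) <= mu (p + q)) /\
  (forall p q, mu p <= mu (lmul p q) /\ mu q <= mu (lmul p q)).

Definition h_condition (X : addSemigroupType) (mu : fuzzy_subset R X) : Prop :=
  forall x z y1 y2 : X,
    x + y1 + z = y2 + z -> Num.min (mu y1) (mu y2) <= mu x.

Definition fuzzy_h_ideal (mu : fuzzy_subset R S) : Prop :=
  fuzzy_ideal mu /\ h_condition mu.

Definition fuzzy_left_op_h_ideal (mu : fuzzy_subset R (left_op M)) : Prop :=
  fuzzy_left_op_ideal mu /\ h_condition mu.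

Lemma inf_range01 (Y : Type) (f : Y -> R) :
  inhabited Y -> (forall y, 0 <= f y <= 1) -> 0 <= inf (range f) <= 1.
Proof.
move=> [y] f01; have lb : lbound (range f) 0.
  by move=> _ [z _ <-]; case/andP: (f01 z).
apply/andP; split; first by apply: lb_le_inf => //; exists (f y), y.
have /andP[_] := f01 y; apply: le_trans; apply: ge_inf; first by exists 0.
by exists y.
Qed.

(* sigma^{+'} and mu^{+} *)
Definition fuzzy_plus' (sigma : fuzzy_subset R S) :
    fuzzy_subset R (left_op M) :=
  @FuzzySubset R (left_op M)
    (fun p => inf (range (fun a : S => sigma (lact p a))))
    (fun p => inf_range01 (gS_inhabited M)
       (fun a => fuzzy_val01 sigma (lact p a))).

Definition fuzzy_plus (mu : fuzzy_subset R (left_op M)) : fuzzy_subset R S :=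
  @FuzzySubset R S
    (fun a => inf (range (fun al : G => mu (lgen M a al))))
    (fun a => inf_range01 (gG_inhabited M)
       (fun al => fuzzy_val01 mu (lgen M a al))).

End FuzzyIdeals.

(* Main.v *)
Require Import Defs.
From mathcomp Require Import all_boot all_order all_algebra reals.
From mathcomp Require Import classical_sets.

Import Order.TTheory.
Local Open Scope ring_scope.

(** Both constructions are infima of a fuzzy set pulled back along additive maps: p to p a for each
    a in S, and a to [a, al] for each al in G. Additive maps preserve the equation x + y1 + z = y2 +
    z and turn sums into sums, so the min inequalities hold for each parameter and pass to the
    infimum. Products are absorbed because (pq)a = p(qa), with [fuzzy_ideal_lact] handling the outer
    factor, and because [a al b, be] = [a, al][b, be] ([lgenM]). *)

Lemma le_inf_range (R : realType) (Y : Type) (f : Y -> R) (c : R) :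
  inhabited Y -> (forall y, c <= f y) -> c <= inf (range f).
Proof.
by move=> [y] cf; apply: lb_le_inf; [exists (f y), y | move=> _ [z _ <-]].
Qed.

(** Fuzzy values are at least 0, so the range is bounded below and its [inf] is a genuine lower
    bound. *)
Lemma fuzzy_inf_le (R : realType) (X Y : Type) (mu : fuzzy_subset R X)
    (h : Y -> X) (y : Y) :
  inf (range (fun z => mu (h z))) <= mu (h y).
Proof.
apply: ge_inf; last by exists y.
by exists 0 => _ [z _ <-]; case/andP: (fuzzy_val01 mu (h z)).
Qed.

Section GammaSemiring.
Variables (R : realType) (S G : addSemigroupType) (M : gamma_semiring S G).

(** Induction on a formal sum representing p: each term x al a absorbs a, and a sum of elements of
    value at least [sigma a] again has value at least [sigma a]. *)
Lemma fuzzy_ideal_lact (sigma : fuzzy_subset R S) (p : left_op M) (a : S) :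
  fuzzy_ideal M sigma -> sigma a <= sigma (lact p a).
Proof.
move=> [sD sM]; rewrite /lact; elim/fsum_ind: (repr p) => [x|f g af ag].
  by rewrite /fact fsum_eval1; case: (sM x.1 x.2 a).
by rewrite factD; apply: le_trans (sD _ _); rewrite le_min af.
Qed.

(** L acts faithfully on S, so it suffices to compare actions. *)
Lemma lgenD (a b : S) (al : G) : lgen M (a + b) al = lgen M a al + lgen M b al.
Proof. by apply: lact_inj => c; rewrite lactD !lact_lgen gactDl. Qed.

Lemma lgenM (a b : S) (al be : G) :
  lgen M (M a al b) be = lmul (lgen M a al) (lgen M b be).
Proof. by apply: lact_inj => c; rewrite lactM !lact_lgen gactA. Qed.

Lemma fuzzy_plus'_h_ideal (sigma : fuzzy_subset R S) :
  fuzzy_h_ideal M sigma -> fuzzy_left_op_h_ideal (fuzzy_plus' M sigma).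
Proof.
move=> [sI sh]; have [sD _] := sI; have S0 := gS_inhabited M.
have le_lact p a : fuzzy_plus' M sigma p <= sigma (lact p a).
  exact: (fuzzy_inf_le _ _ _ sigma (lact p)).
split; first split=> p q; last 1 first.
- move=> x z y1 y2 e; apply: le_inf_range => // a.
  have ea : lact x a + lact y1 a + lact z a = lact y2 a + lact z a.
    by rewrite -!lactD e.
  by apply: le_trans (sh _ _ _ _ ea); apply: le_min2; apply: le_lact.
- apply: le_inf_range => // a; rewrite lactD; apply: le_trans (sD _ _).
  by apply: le_min2; apply: le_lact.
(* For the left factor, p(qa) is already one of the values in the infimum for p, taken at the point
   qa. For the right factor, p acts on qa without lowering [sigma]. *)
- split; apply: le_inf_range => // a; rewrite lactM; first exact: le_lact.
  by apply: le_trans (le_lact q a) _; apply: fuzzy_ideal_lact.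
Qed.

Lemma fuzzy_plus_h_ideal (mu : fuzzy_subset R (left_op M)) :
  fuzzy_left_op_h_ideal mu -> fuzzy_h_ideal M (fuzzy_plus mu).
Proof.
move=> [[mD mM] mh]; have G0 := gG_inhabited M.
have le_lgen a al : fuzzy_plus mu a <= mu (lgen M a al).
  exact: (fuzzy_inf_le _ _ _ mu (lgen M a)).
split; first split; last 1 first.
- move=> x z y1 y2 e; apply: le_inf_range => // al.
  have ea : lgen M x al + lgen M y1 al + lgen M z al
      = lgen M y2 al + lgen M z al by rewrite -!lgenD e.
  by apply: le_trans (mh _ _ _ _ ea); apply: le_min2; apply: le_lgen.
- move=> a b; apply: le_inf_range => // al; rewrite lgenD.
  by apply: le_trans (mD _ _); apply: le_min2; apply: le_lgen.
(* The infimum for a is evaluated at the [al] of the product, the one for b at the running parameter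
   [be]. *)
- move=> a al b; split; apply: le_inf_range => // be; rewrite lgenM.
    by apply: le_trans (le_lgen a al) _; case: (mM (lgen M a al) (lgen M b be)).
  by apply: le_trans (le_lgen b be) _; case: (mM (lgen M a al) (lgen M b be)).
Qed.

End GammaSemiring.

Theorem proposition3p8 (R : realType) (S G : addSemigroupType)
    (M : gamma_semiring S G)
    (hl : has_left_unity M) (hr : has_right_unity M) :
  (forall sigma : fuzzy_subset R S,
     fuzzy_h_ideal M sigma ->
     fuzzy_left_op_h_ideal (fuzzy_plus' M sigma)) /\
  (forall mu : fuzzy_subset R (left_op M),
     fuzzy_left_op_h_ideal mu -> fuzzy_h_ideal M (fuzzy_plus mu)).
Proof.
by split; [exact: fuzzy_plus'_h_ideal | exact: fuzzy_plus_h_ideal].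
Qed.
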